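(* Let $g$ be a balancing function that is non-decreasing and continuous on $[0,\infty)$. Then: (a) $\lambda(x)<\infty$ for $\pi$-almost every $x$. (b) $Z_\lambda:=\int_E\lambda(x)\,\pi(dx)<\infty$, so that $\tilde\pi(dx)=Z_\lambda^{-1}\lambda(x)\,\pi(dx)$ is a probability measure on $E$. (c) $\Gamma_g$ is a $\tilde\pi$-reversible discrete-time Markov transition kernel.
   Context: Let $E$ be a Polish space with Borel $\sigma$-algebra $\mathcal{E}$, $\pi$ a probability measure on $(E,\mathcal{E})$, and $\gamma:E\times\mathcal{E}\to[0,1]$ a Markov kernel. Write $[\pi\otimes\gamma](dx,dy)=\pi(dx)\gamma(x,dy)$. The function $t:E\times E\to[0,\infty)$ is a version of the Radon--Nikodym derivative $t(x,y)=\frac{\pi(dy)\gamma(y,dx)}{\pi(dx)\gamma(x,dy)}$ such that, for some measurable $R\subset E\times E$ with $[\pi\otimes\gamma](R)=1$, one has $0<t(x,y)<\infty$ and $t(y,x)=1/t(x,y)$ for $(x,y)\in R$, and $t(x,y)=0$ for $(x,y)\notin R$. A balancing function is a (Borel) function $g:[0,\infty)\to[0,\infty)$ with $g(1)=1$, $g(0)=0$, $g(s)>0$ for $s>0$, and $g(s)=s\,g(1/s)$ for all $s>0$. Jump rate: $\lambda(x)=\int_E g(t(x,y))\,\gamma(x,dy)\in[0,\infty]$. Kernel: $\Gamma_g(x,A)=\int_A \frac{g(t(x,y))}{\lambda(x)}\,\gamma(x,dy)$ for $A\in\mathcal{E}$ (at degenerate points, where $\lambda(x)\in\{0,\infty\}$,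 set $\Gamma_g(x,\cdot)=\delta_x$). Reversibility with respect to $\tilde\pi$ means $\int_A\tilde\pi(dx)\Gamma_g(x,B)=\int_B\tilde\pi(dx)\Gamma_g(x,A)$ for all $A,B\in\mathcal{E}$. *)

(* Defs.v *)
From HB Require Import structures.
From mathcomp Require Import all_boot all_order all_algebra.
From mathcomp Require Import all_classical all_reals all_analysis.

Set Implicit Arguments.
Unset Strict Implicit.
Unset Printing Implicit Defensive.

Import Order.TTheory GRing.Theory Num.Theory.
Import numFieldNormedType.Exports.

Local Open Scope classical_set_scope.
Local Open Scope ring_scope.
Local Open Scope ereal_scope.

Definition separable (E : topologicalType) : Prop :=
  exists2 D : set E, countable D & dense D.

Definition is_distance (R : realType) (T : Type) (d : T -> T -> R) : Prop :=
  [/\ forall x y, (0 <= d x y)%R,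
      forall x y, d x y = 0%R <-> x = y,
      forall x y, d x y = d y x &
      forall x y z, (d x z <= d x y + d y z)%R].

Definition induces_topology (R : realType) (E : topologicalType)
    (d : E -> E -> R) : Prop :=
  forall U : set E, open U <->
    forall x, U x -> exists2 e : R, (0 < e)%R & [set y | (d x y < e)%R] `<=` U.

Definition complete_distance (R : realType) (T : Type) (d : T -> T -> R) :
    Prop :=
  forall u : nat -> T,
    (forall e : R, (0 < e)%R -> exists N : nat, forall m n : nat,
      (N <= m)%N -> (N <= n)%N -> (d (u m) (u n) < e)%R) ->
    exists l : T, forall e : R, (0 < e)%R -> exists N : nat, forall n : nat,
      (N <= n)%N -> (d (u n) l < e)%R.

Definition polish (R : realType) (E : topologicalType) : Prop :=
  separable E /\
  exists d : E -> E -> R,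
    [/\ is_distance d, induces_topology d & complete_distance d].

(* g_sigma_algebraType needs a pointed carrier; this is no restriction on a
   space that carries a probability measure. *)
Notation borel E := (g_sigma_algebraType (@open E)).

Section otimes.
Context d1 d2 (T1 : measurableType d1) (T2 : measurableType d2) (R : realType).
Variables (mu : probability T1 R) (k : R.-pker T1 ~> T2).

Definition otimes (A : set (T1 * T2)) : \bar R :=
  \int[mu]_x k x (xsection A x).

Let otimes0 : otimes set0 = 0.
Proof.
by rewrite /otimes; apply: integral0_eq => x _; rewrite xsection0 measure0.
Qed.

Let otimes_ge0 A : 0 <= otimes A.
Proof. by rewrite /otimes; apply: integral_ge0. Qed.

Let otimes_sigma_additive : semi_sigma_additive otimes.
Proof.
move=> F mF tF mUF.
rewrite [X in _ --> X](_ : _ =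
    \sum_(n <oo) \int[mu]_x k x (xsection (F n) x)).
  by apply: is_cvg_nneseries => n _ _; exact: otimes_ge0.
rewrite -integral_nneseries//; last first.
  by move=> n; exact: measurable_fun_xsection_finite_kernel (mem_set (mF n)).
apply: eq_integral => x _; rewrite xsection_bigcup.
apply/esym/cvg_lim => //.
apply: (measure_sigma_additive _ (trivIset_xsection tF)) => n.
exact: measurable_xsection.
Qed.

HB.instance Definition _ := isMeasure.Build _ _ _
  otimes otimes0 otimes_ge0 otimes_sigma_additive.

Let otimes_setT : otimes setT = 1.
Proof.
rewrite /otimes (eq_integral (cst 1)); last first.
  by move=> x _; rewrite xsectionE preimage_setT prob_kernel.
rewrite integral_cst// mul1e; exact: (probability_setT mu).
Qed.

HB.instance Definition _ := Measure_isProbability.Build _ _ _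
  otimes otimes_setT.

End otimes.

Section jump.
Context d (E : measurableType d) (R : realType).
Variables (pi : probability E R) (gamma : R.-pker E ~> E).

(* pushing [pi ⊗ gamma](dx,dy) forward along the swap gives the measure
   pi(dy) gamma(y,dx) in the numerator of the derivative. *)
Definition is_ratio (t : E * E -> R) : Prop :=
  [/\ measurable_fun setT t,
      forall z, (0 <= t z)%R,
      forall A, measurable A ->
        pushforward (otimes pi gamma) (@swap_pair E E) A =
        \int[otimes pi gamma]_(z in A) (t z)%:E &
      exists S : set (E * E),
        [/\ measurable S, otimes pi gamma S = 1,
            forall x y, S (x, y) ->
              (0 < t (x, y))%R /\ t (y, x) = ((t (x, y))^-1)%R &
            forall z, ~ S z -> t z = 0%R]].

(* only the values of g on [0, +oo[ are constrained, and only those are used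
   below since t >= 0. *)
Definition balancing (g : R -> R) : Prop :=
  [/\ measurable_fun (`[0%R, +oo[%classic : set R) g,
      g 1%R = 1%R,
      g 0%R = 0%R,
      forall s : R, (0 < s)%R -> (0 < g s)%R &
      forall s : R, (0 < s)%R -> g s = (s * g s^-1)%R].

Variables (g : R -> R) (t : E * E -> R).

Definition jump_rate (x : E) : \bar R := \int[gamma x]_y (g (t (x, y)))%:E.

Definition jump_kernel (x : E) (A : set E) : \bar R :=
  if (jump_rate x == 0) || (jump_rate x == +oo) then \d_x A
  else \int[gamma x]_(y in A) ((g (t (x, y)))%:E / jump_rate x).

Definition Zlambda : \bar R := \int[pi]_x jump_rate x.

Definition pi_tilde (A : set E) : \bar R :=
  Zlambda^-1 * \int[pi]_(x in A) jump_rate x.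

End jump.

Section kernels.
Context d (E : measurableType d) (R : realType).

Definition is_markov_kernel (K : E -> set E -> \bar R) : Prop :=
  exists k : R.-pker E ~> E, forall x A, measurable A -> k x A = K x A.

Definition reversible (mu : {measure set E -> \bar R})
    (K : E -> set E -> \bar R) : Prop :=
  forall A B, measurable A -> measurable B ->
    \int[mu]_(x in A) K x B = \int[mu]_(x in B) K x A.

End kernels.

(* Main.v *)
Require Import Defs.
From HB Require Import structures.
From mathcomp Require Import all_boot all_order all_algebra.
From mathcomp Require Import all_classical all_reals all_analysis.
From mathcomp Require Import measurable_realfun.

Import Order.TTheory GRing.Theory Num.Theory.
Import numFieldNormedType.Exports.

Local Open Scope classical_set_scope.
Local Open Scope ring_scope.
Local Open Scope ereal_scope.

Set Implicit Arguments.
Unset Strict Implicit.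
Unset Printing Implicit Defensive.

(** The rate at which the process flows from [x] to [y] is [g (t (x, y))]
    against the measure pi(dx) gamma(x, dy), which is [otimes pi gamma].  The
    balancing equation [g s = s * g s^-1], applied to [s = t (x, y)] with
    [t (y, x) = (t (x, y))^-1], says

      g (t (x, y)) = t (x, y) * g (t (y, x)),

    and [t] is precisely the density that turns [otimes pi gamma] into its
    image under the exchange of coordinates.  Hence the total flow from [A]
    to [B] equals the total flow from [B] to [A] ([rate_swap],
    [flow_symmetric]).  At a point where [0 < lambda x < +oo], multiplying
    [jump_kernel x] by [lambda x] gives back the flow out of [x]; this stays
    true where [lambda x = 0], both sides being zero ([jump_rate_kernel]).  As
    [lambda] is finite almost everywhere, integrating the kernel against
    pi_tilde gives the flow divided by [Zlambda] ([tilted_flow]), and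
    reversibility is the symmetry of the flow.

    Finiteness comes from the bound [g s <= 1 + s] ([balancing_le1D]): for
    [s <= 1] by monotonicity, for [s >= 1] because [g s = s * g s^-1 <= s].
    Since [t] has integral 1 against [otimes pi gamma], being the density of a
    probability, [Zlambda <= 2] and [lambda] is finite almost everywhere.
    Moreover [Zlambda] is not zero, since [g (t z) > 0] almost everywhere; so
    pi_tilde is a probability.

    Two integration formulas carry the computations: integration against
    [otimes pi gamma] is iterated integration ([ge0_integral_otimes]), and
    integration against a measure with density [w] is integration of the
    product with [w] ([ge0_integral_density]).  Both are instances of one
    uniqueness principle ([ge0_integral_functional]). *)

(** * Integrals as functionals of nonnegative functions *)

Section functional.
Context d (T : measurableType d) (R : realType).
Variables (m : {measure set T -> \bar R}) (J : (T -> \bar R) -> \bar R).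
Hypothesis J_indic : forall A, measurable A -> J (EFin \o \1_A) = m A.
Hypothesis J_add : forall f g : T -> \bar R,
  measurable_fun setT f -> measurable_fun setT g ->
  (forall x, 0 <= f x) -> (forall x, 0 <= g x) ->
  J (fun x => f x + g x) = J f + J g.
Hypothesis J_scale : forall (r : R) (f : T -> \bar R), (0 <= r)%R ->
  measurable_fun setT f -> (forall x, 0 <= f x) ->
  J (fun x => r%:E * f x) = r%:E * J f.
Hypothesis J_lim : forall f_ : (T -> \bar R)^nat,
  (forall n, measurable_fun setT (f_ n)) -> (forall n x, 0 <= f_ n x) ->
  (forall x, nondecreasing_seq (f_ ^~ x)) ->
  J (fun x => limn (f_ ^~ x)) = limn (J \o f_).

Let J_sum (I : Type) (s : seq I) (f : I -> T -> \bar R) :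
  (forall i, measurable_fun setT (f i)) -> (forall i x, 0 <= f i x) ->
  J (fun x => \sum_(i <- s) f i x) = \sum_(i <- s) J (f i).
Proof.
move=> mf f0; elim: s => [|i s IH].
  rewrite big_nil; transitivity (J (EFin \o \1_set0)).
    by congr J; apply/funext => x; rewrite big_nil /= indic0.
  by rewrite J_indic// measure0.
rewrite big_cons -IH -J_add//.
- by congr J; apply/funext => x; rewrite big_cons.
- exact: emeasurable_sum.
- by move=> x; exact: sume_ge0.
Qed.

Import HBNNSimple.

(** A functional that is additive, positively homogeneous and compatible with
    increasing limits is determined by its values on indicators, because every
    nonnegative measurable function is an increasing limit of finite
    nonnegative combinations of indicators. *)
Lemma ge0_integral_functional (f : T -> \bar R) :
  measurable_fun setT f -> (forall x, 0 <= f x) -> \int[m]_x f x = J f.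
Proof.
move=> mf f0; pose f_ := nnsfun_approx measurableT mf.
have f_lim x : limn (fun n => (f_ n x)%:E) = f x.
  by apply/cvg_lim => //; exact: cvg_nnsfun_approx.
have f_nd x : nondecreasing_seq (fun n => (f_ n x)%:E).
  by move=> a b ab; rewrite lee_fin; exact/lefP/nd_nnsfun_approx.
have mf_ n : measurable_fun setT (EFin \o f_ n) by exact/measurable_EFinP.
have f_0 n x : 0 <= (EFin \o f_ n) x by rewrite /= lee_fin.
have -> : J f = limn (J \o (fun n => EFin \o f_ n)).
  rewrite -J_lim//; congr J; apply/funext => x.
  by rewrite -[LHS]f_lim.
under eq_integral do rewrite -f_lim.
rewrite monotone_convergence//; last by move=> n x _; exact: f_0.
congr (limn _); apply/funext => n /=.
(* The canonical decomposition of a simple function ranges over real values;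
   truncating the coefficient at 0 changes nothing, as negative values have an
   empty fibre, and makes every coefficient nonnegative at once. *)
have fE x : (f_ n x)%:E = \sum_(r <- finmap.enum_fset (fset_set (range (f_ n))))
    (Num.max r 0)%:E * (\1_(f_ n @^-1` [set r]) x)%:E.
  rewrite fimfunE fsbig_finite//= -sumEFin; apply: eq_bigr => r _.
  rewrite EFinM; have [r0|r0] := leP 0%R r; first by [].
  by rewrite preimage_nnfun0// indic0 !mule0.
have fiber_ge0 r x : 0 <= (\1_(f_ n @^-1` [set r]) x)%:E :> \bar R.
  by rewrite lee_fin.
have mindic r :
    measurable_fun setT (EFin \o \1_(f_ n @^-1` [set r]) : T -> \bar R).
  exact/measurable_EFinP.
have max0 (r : R) : (0 <= Num.max r 0)%R by rewrite le_max lexx orbT.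
under eq_integral do rewrite fE.
rewrite ge0_integral_sum//; last 2 first.
- by move=> r; apply: measurable_funeM; exact: mindic.
- by move=> r x _; apply: mule_ge0 => //; rewrite lee_fin.
transitivity (J (fun x => \sum_(r <- finmap.enum_fset (fset_set (range (f_ n))))
    (Num.max r 0)%:E * (EFin \o \1_(f_ n @^-1` [set r])) x)); last first.
  congr J; apply/funext => x; exact/esym/fE.
rewrite J_sum; last 2 first.
- by move=> r; apply: measurable_funeM; exact: mindic.
- by move=> r x; apply: mule_ge0 => //; rewrite lee_fin.
apply: eq_bigr => r _.
rewrite (J_scale (f := EFin \o \1_(f_ n @^-1` [set r])))//; last first.
  exact: fiber_ge0.
rewrite J_indic// ge0_integralZl//; [|exact: mindic|by rewrite lee_fin].
by rewrite /= integral_indic// setIT.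
Qed.

End functional.

(** The density is taken real-valued so that multiplication by [w x] is
    continuous on the extended reals and passes to increasing limits. *)
Lemma ge0_integral_density d (T : measurableType d) (R : realType)
    (mu nu : {measure set T -> \bar R}) (w : T -> R) (f : T -> \bar R) :
  measurable_fun setT w -> (forall x, 0 <= w x)%R ->
  (forall A, measurable A -> nu A = \int[mu]_(x in A) (w x)%:E) ->
  measurable_fun setT f -> (forall x, 0 <= f x) ->
  \int[nu]_x f x = \int[mu]_x (f x * (w x)%:E).
Proof.
move=> mw w0 nuE mf f0.
have mW : measurable_fun setT (EFin \o w) by exact/measurable_EFinP.
have fw0 (g : T -> \bar R) : (forall x, 0 <= g x) ->
    forall x, 0 <= g x * (w x)%:E.
  by move=> g0 x; rewrite mule_ge0// lee_fin.
rewrite (@ge0_integral_functional _ _ _ nu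
  (fun g => \int[mu]_x (g x * (w x)%:E)))//.
- move=> A mA; rewrite nuE// [RHS]integral_mkcond epatch_indic.
  by apply: eq_integral => x _; rewrite muleC.
- move=> g h mg mh g0 h0; rewrite -ge0_integralD//.
  + by apply: eq_integral => x _; rewrite ge0_muleDl.
  + by move=> x _; exact: fw0.
  + exact: emeasurable_funM.
  + by move=> x _; exact: fw0.
  + exact: emeasurable_funM.
- move=> r g r0 mg g0; rewrite -ge0_integralZl//.
  + by apply: eq_integral => x _; rewrite muleA.
  + exact: emeasurable_funM.
  + by move=> x _; exact: fw0.
- move=> g_ mg g0 ndg; rewrite -monotone_convergence//.
  + apply: eq_integral => x _; apply/esym/cvg_lim => //; apply: cvgeZr => //.
    by apply: ereal_nondecreasing_is_cvgn; exact: ndg.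
  + by move=> n; exact: emeasurable_funM.
  + by move=> n x _; exact: fw0.
  + move=> x _ a b ab; rewrite lee_wpmul2r ?lee_fin//; exact: ndg.
Qed.

Lemma ge0_integral_otimes d1 d2 (T1 : measurableType d1)
    (T2 : measurableType d2) (R : realType) (mu : probability T1 R)
    (k : R.-pker T1 ~> T2) (f : T1 * T2 -> \bar R) :
  measurable_fun setT f -> (forall z, 0 <= f z) ->
  \int[otimes mu k]_z f z = \int[mu]_x \int[k x]_y f (x, y).
Proof.
move=> mf f0.
have mx (g : T1 * T2 -> \bar R) : measurable_fun setT g ->
    forall x, measurable_fun setT (fun y => g (x, y)).
  by move=> mg x; exact: measurable_fun_pair2.
have mi (g : T1 * T2 -> \bar R) : measurable_fun setT g ->
    (forall z, 0 <= g z) -> measurable_fun setT (fun x => \int[k x]_y g (x, y)).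
  by move=> mg g0; exact: measurable_fun_integral_finite_kernel.
have i0 (g : T1 * T2 -> \bar R) : (forall z, 0 <= g z) ->
    forall x, 0 <= \int[k x]_y g (x, y).
  by move=> g0 x; exact: integral_ge0.
rewrite (@ge0_integral_functional _ _ _ (otimes mu k)
  (fun g => \int[mu]_x \int[k x]_y g (x, y)))//.
- move=> A mA; rewrite /= /otimes; apply: eq_integral => x _.
  by have := congr1 (@^~ x) (kfcompkindic k mA).
- move=> g h mg mh g0 h0; rewrite -ge0_integralD//; last 4 first.
  + by move=> x _; exact: i0.
  + exact: mi.
  + by move=> x _; exact: i0.
  + exact: mi.
  apply: eq_integral => x _; rewrite ge0_integralD//; exact: mx.
- move=> r g r0 mg g0; rewrite -ge0_integralZl//; last 2 first.
  + exact: mi.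
  + by move=> x _; exact: i0.
  by apply: eq_integral => x _; rewrite ge0_integralZl//; exact: mx.
- move=> g_ mg g0 ndg; rewrite -monotone_convergence//; last 3 first.
  + by move=> n; exact: mi.
  + by move=> n x _; exact: i0.
  + move=> x _ a b ab; apply: ge0_le_integral => //; [exact: mx|exact: mx|].
    by move=> y _; exact: ndg.
  apply: eq_integral => x _; rewrite -monotone_convergence//.
  by move=> n; exact: mx.
Qed.

(** * Measures given by a density *)

Section with_density.
Context d (T : measurableType d) (R : realType).
Variables (mu : {measure set T -> \bar R}) (w : T -> \bar R).
Hypotheses (mw : measurable_fun setT w) (w0 : forall x, 0 <= w x).

(** The proofs are arguments of the function so that unification recovers them
    when the measure structure of [with_density mu mw w0] is looked up. *)
Definition with_density of measurable_fun setT w & (forall x, 0 <= w x) :=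
  fun A : set T => \int[mu]_(x in A) w x.

Local Notation nu := (with_density mw w0).

Let with_density0 : nu set0 = 0.
Proof. by rewrite /with_density integral_set0. Qed.

Let with_density_ge0 A : 0 <= nu A.
Proof. by apply: integral_ge0 => x _; exact: w0. Qed.

Let with_density_sigma_additive : semi_sigma_additive nu.
Proof.
move=> F mF tF mUF; rewrite /with_density ge0_integral_bigcup//.
  by apply: is_cvg_nneseries => n _ _; exact: with_density_ge0.
exact: measurable_funTS.
Qed.

HB.instance Definition _ := isMeasure.Build _ _ _ nu
  with_density0 with_density_ge0 with_density_sigma_additive.

End with_density.

(** * Balancing functions *)

Section balancing_function.
Context (R : realType) (g : R -> R).
Hypotheses (gP : balancing g)
  (g_ndecr : forall r s : R, (0 <= r)%R -> (r <= s)%R -> (g r <= g s)%R).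

Lemma balancing_ge0 (s : R) : (0 <= s)%R -> (0 <= g s)%R.
Proof.
case: gP => _ _ g0 gpos _; rewrite le_eqVlt => /predU1P[<-|/gpos/ltW//].
by rewrite g0.
Qed.

(** Below 1 monotonicity compares with [g 1 = 1]; above 1 the balancing equation
    brings the argument [s^-1] back below 1. *)
Lemma balancing_le1D (s : R) : (0 <= s)%R -> (g s <= 1 + s)%R.
Proof.
case: gP => _ g1 _ _ gsym s0; have [s1|s1] := leP s 1%R.
  by rewrite (le_trans (g_ndecr s0 s1))// g1 lerDl.
have s_gt0 : (0 < s)%R by rewrite (lt_trans _ s1).
rewrite gsym// (@le_trans _ _ s)// ?lerDr//.
rewrite -[leRHS]mulr1 ler_pM2l// -g1 g_ndecr ?invr_ge0//.
by rewrite invf_le1// ltW.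
Qed.

End balancing_function.

(** * The jump rate and the flow *)

Section jump_process.
Context d (E : measurableType d) (R : realType).
Variables (pi : probability E R) (gamma : R.-pker E ~> E).
Variables (t : E * E -> R) (g : R -> R).
Hypotheses (tP : is_ratio pi gamma t) (gP : balancing g)
  (g_ndecr : forall r s : R, (0 <= r)%R -> (r <= s)%R -> (g r <= g s)%R).

Local Notation mu := (otimes pi gamma).
Local Notation lambda := (jump_rate gamma g t).
Local Notation h := (fun z => (g (t z))%:E).
Local Notation Z := (Zlambda pi gamma g t).

Let t_ge0 z : (0 <= t z)%R. Proof. by case: tP. Qed.
Let measurable_t : measurable_fun setT t. Proof. by case: tP. Qed.

Lemma rate_ge0 z : 0 <= h z.
Proof. by rewrite lee_fin (balancing_ge0 gP). Qed.

Lemma measurable_rate : measurable_fun setT h.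
Proof.
apply/measurable_EFinP; case: gP => mg _ _ _ _.
apply: (measurable_comp _ _ mg) => //.
by move=> _ [z _ <-]; rewrite /= in_itv/= t_ge0.
Qed.

(** Outside the symmetric set where [t] is positive both sides vanish, because
    [g 0 = 0]; so the equation holds everywhere and not just almost
    everywhere. *)
Lemma rate_swap z : h z = h (swap_pair z) * (t z)%:E.
Proof.
case: tP => _ _ _ [S [_ _ tS tNS]]; case: gP => _ _ g0 _ gsym.
have [Sz|/tNS ->] := pselect (S z); last by rewrite g0 mule0.
case: z Sz => x y /tS[tpos txy].
by rewrite /swap_pair/= txy -EFinM mulrC -gsym.
Qed.

Lemma measurable_jump_rate : measurable_fun setT lambda.
Proof.
exact: (measurable_fun_integral_finite_kernel h gamma rate_ge0 measurable_rate).
Qed.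

Lemma jump_rate_ge0 x : 0 <= lambda x.
Proof. by apply: integral_ge0 => y _; exact: rate_ge0. Qed.

Lemma Zlambda_ge0 : 0 <= Z.
Proof. by apply: integral_ge0 => x _; exact: jump_rate_ge0. Qed.

Lemma ZlambdaE : Z = \int[mu]_z h z.
Proof. by rewrite (ge0_integral_otimes _ _ measurable_rate rate_ge0). Qed.

(** The density [t] integrates to the mass of the image of [otimes pi gamma]
    under the swap, which is 1. *)
Lemma Zlambda_lty : Z < +oo.
Proof.
rewrite ZlambdaE (@le_lt_trans _ _ (\int[mu]_z (1 + (t z)%:E)))//.
  apply: ge0_le_integral => //.
  - by move=> z _; exact: rate_ge0.
  - exact: measurable_rate.
  - by apply: emeasurable_funD => //; exact/measurable_EFinP.
  - by move=> z _; rewrite -EFinD lee_fin (balancing_le1D gP).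
rewrite ge0_integralD//; last 2 first.
- by move=> z _; rewrite lee_fin.
- exact/measurable_EFinP.
have <- : mu setT = \int[mu]_z (t z)%:E.
  by case: tP => _ _ /(_ setT measurableT) <- _.
rewrite integral_cst// mul1e.
by rewrite lte_add_pinfty// [ltLHS](probability_setT mu) ltey.
Qed.

(** If the integral of the rate vanished, the rate would vanish almost
    everywhere, whereas it is positive on a set of full measure. *)
Lemma Zlambda_neq0 : Z != 0.
Proof.
apply/eqP; rewrite ZlambdaE => h0.
have : {ae mu, forall z, setT z -> h z = 0}.
  apply/ae_eq_integral_abs => //; first exact: measurable_rate.
  by rewrite -[RHS]h0; apply: eq_integral => z _; rewrite gee0_abs// rate_ge0.
case: tP => _ _ _ [S [mS muS tS _]]; case: gP => _ _ _ gpos _.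
case=> N [mN muN hN]; suff : mu S <= 0 by rewrite muS lee_fin ler10.
rewrite -muN le_measure ?inE//.
apply: subset_trans hN => -[x y] /tS[tpos _] /= /(_ I)[] /eqP.
by rewrite gt_eqF// gpos.
Qed.

Lemma jump_rate_ae_lty : {ae pi, forall x, lambda x < +oo}.
Proof.
have : pi.-integrable setT lambda.
  apply/integrableP; split; first exact: measurable_jump_rate.
  under eq_integral do rewrite gee0_abs ?jump_rate_ge0//.
  exact: Zlambda_lty.
move=> /integrable_ae => /(_ measurableT); apply: filterS => x /= /(_ I).
by rewrite ge0_fin_numE// jump_rate_ge0.
Qed.

Lemma flowE A B : measurable A -> measurable B ->
  \int[pi]_(x in A) \int[gamma x]_(y in B) h (x, y) =
  \int[mu]_(z in A `*` B) h z.
Proof.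
move=> mA mB; have mAB : measurable (A `*` B) by exact: measurableX.
rewrite [RHS]integral_mkcond ge0_integral_otimes; last 2 first.
- apply/(measurable_restrictT _ mAB); apply: measurable_funTS.
  exact: measurable_rate.
- by apply: erestrict_ge0 => z _; exact: rate_ge0.
rewrite integral_mkcond; apply: eq_integral => x _.
rewrite /patch; case: ifPn => xA.
  rewrite integral_mkcond; apply: eq_integral => y _; rewrite /patch.
  by rewrite in_setX xA.
by rewrite integral0_eq// => y _; rewrite in_setX (negbTE xA).
Qed.

(** Detailed balance for the unnormalized flow: the factor [t] produced by
    [rate_swap] changes [otimes pi gamma] into its image under the swap. *)
Lemma flow_symmetric A B : measurable A -> measurable B ->
  \int[pi]_(x in A) \int[gamma x]_(y in B) h (x, y) =
  \int[pi]_(x in B) \int[gamma x]_(y in A) h (x, y).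
Proof.
move=> mA mB; have mAB : measurable (A `*` B) by exact: measurableX.
have mswap : measurable_fun setT (@swap_pair E E) by exact: measurable_fun_pair.
have mh : measurable_fun setT (h \o swap_pair).
  by apply: measurableT_comp => //; exact: measurable_rate.
rewrite !flowE// integral_mkcond.
transitivity (\int[pushforward mu (@swap_pair E E)]_z
    ((h \o swap_pair) \_ (A `*` B)) z).
  rewrite [RHS](@ge0_integral_density _ _ _ mu _ t)//.
  - apply: eq_integral => z _; rewrite /patch; case: ifPn => _.
      exact: rate_swap.
    by rewrite mul0e.
  - by case: tP.
  - by apply/(measurable_restrictT _ mAB); exact/measurable_funTS.
  - by apply: erestrict_ge0 => z _; exact: rate_ge0.
rewrite -integral_mkcond ge0_integral_pushforward//.
- have -> : swap_pair @^-1` (A `*` B) = B `*` A.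
    by apply/seteqP; split => -[x y] [].
  by apply: eq_integral => -[x y] _.
- exact: measurable_funTS.
- by move=> z _; exact: rate_ge0.
Qed.

(** * The jump kernel *)

Lemma measurable_integral_rate B : measurable B ->
  measurable_fun setT (fun x => \int[gamma x]_(y in B) h (x, y)).
Proof.
move=> mB; have mTB : measurable (setT `*` B : set (E * E)).
  exact: measurableX.
have -> : (fun x => \int[gamma x]_(y in B) h (x, y)) =
    (fun x => \int[gamma x]_y (h \_ (setT `*` B)) (x, y)).
  apply/funext => x; rewrite integral_mkcond; apply: eq_integral => y _.
  by rewrite /patch in_setX in_setT.
apply: measurable_fun_integral_finite_kernel.
  by apply: erestrict_ge0 => z _; exact: rate_ge0.
apply/(measurable_restrictT _ mTB); apply: measurable_funTS.
exact: measurable_rate.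
Qed.

Lemma integral_rate_ge0 x B : 0 <= \int[gamma x]_(y in B) h (x, y).
Proof. by apply: integral_ge0 => y _; exact: rate_ge0. Qed.

Let rate_section x : measurable_fun setT (fun y => h (x, y)).
Proof. exact: (measurable_fun_pair2 x measurable_rate). Qed.

Let normalized_rate x y := h (x, y) / lambda x.

Let measurable_normalized_rate x : measurable_fun setT (normalized_rate x).
Proof. by apply: emeasurable_funM => //; exact: rate_section. Qed.

Let normalized_rate_ge0 x y : 0 <= normalized_rate x y.
Proof. by rewrite mule_ge0 ?rate_ge0// inve_ge0 jump_rate_ge0. Qed.

Let degenerate x := (lambda x == 0) || (lambda x == +oo).

Let jump_rate_fine x : ~~ degenerate x ->
  exists2 r : R, (0 < r)%R & lambda x = r%:E.
Proof.
rewrite negb_or => /andP[l0 loo]; have := jump_rate_ge0 x.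
case: (lambda x) l0 loo => [r||]//; rewrite eqe lee_fin => r0 _ rge0.
by exists r => //; rewrite lt_neqAle eq_sym r0.
Qed.

Definition jump_measure x : {measure set E -> \bar R} :=
  if degenerate x then \d_x : {measure set E -> \bar R}
  else with_density (gamma x) (measurable_normalized_rate x)
         (normalized_rate_ge0 x) : {measure set E -> \bar R}.

Lemma jump_measureE x A : jump_measure x A = jump_kernel gamma g t x A.
Proof. by rewrite /jump_measure /jump_kernel /degenerate; case: ifPn. Qed.

(** The inverse of the rate is written as a real power, whose measurability in
    the base is known; it is the inverse because the rate is nonnegative. *)
Lemma jump_kernel_regular x A : measurable A -> ~~ degenerate x ->
  jump_kernel gamma g t x A =
  (\int[gamma x]_(y in A) h (x, y)) * ((fine (lambda x)) `^ (-1))%:E.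
Proof.
move=> mA ndx; have [r r0 lr] := jump_rate_fine ndx.
rewrite /jump_kernel -/(degenerate x) (negbTE ndx) ge0_integralZr//.
- by rewrite lr/= powR_inv1 ?ltW// inver gt_eqF.
- by apply: measurable_funTS; exact: rate_section.
- by move=> y _; exact: rate_ge0.
- by rewrite inve_ge0 jump_rate_ge0.
Qed.

Let measurable_jump_measure A : measurable A ->
  measurable_fun setT (jump_measure ^~ A).
Proof.
move=> mA; have -> : jump_measure ^~ A = (fun x =>
    if degenerate x then \d_x A else
    (\int[gamma x]_(y in A) h (x, y)) * ((fine (lambda x)) `^ (-1))%:E).
  apply/funext => x; rewrite jump_measureE; case: ifPn => dx.
    by rewrite /jump_kernel -/(degenerate x) dx.
  exact: jump_kernel_regular.
apply: measurable_fun_ifT.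
- by apply: measurable_or; apply: measurable_fun_eqe => //;
    exact: measurable_jump_rate.
- exact: measurable_fun_dirac.
- apply: emeasurable_funM; first exact: measurable_integral_rate.
  apply/measurable_EFinP.
  apply: (measurableT_comp (measurable_powR _)).
  apply: (measurableT_comp (fine_measurable measurableT)).
  exact: measurable_jump_rate.
Qed.

HB.instance Definition _ :=
  isKernel.Build _ _ _ _ R jump_measure measurable_jump_measure.

Let jump_measure_setT x : jump_measure x setT = 1.
Proof.
have [dx|dx] := boolP (degenerate x).
  by rewrite /jump_measure dx; exact: diracT.
rewrite jump_measureE jump_kernel_regular//.
have [r r0 lr] := jump_rate_fine dx.
rewrite -/(jump_rate gamma g t x) lr/= powR_inv1 ?ltW//.
by rewrite -EFinM mulfV// gt_eqF.
Qed.

HB.instance Definition _ :=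
  Kernel_isProbability.Build _ _ _ _ R jump_measure jump_measure_setT.

Lemma jump_kernel_markov : is_markov_kernel (jump_kernel gamma g t).
Proof.
exists (jump_measure : R.-pker E ~> E) => x A _; exact: jump_measureE.
Qed.

(** At points of rate 0 the kernel is a Dirac mass that has nothing to do with
    the flow, but its weight [lambda x] is 0 and so is the flow out of [x]. *)
Lemma jump_rate_kernel x B : measurable B -> lambda x < +oo ->
  lambda x * jump_kernel gamma g t x B = \int[gamma x]_(y in B) h (x, y).
Proof.
move=> mB loo; have [dx|dx] := boolP (degenerate x).
  have /eqP l0 : lambda x == 0.
    by move: dx => /orP[//|/eqP lE]; move: loo; rewrite lE.
  rewrite l0 mul0e; apply/esym/eqP; rewrite eq_le integral_rate_ge0 andbT.
  rewrite -l0; apply: ge0_subset_integral => //.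
  by move=> y _; exact: rate_ge0.
rewrite jump_kernel_regular//; have [r r0 lr] := jump_rate_fine dx.
rewrite lr/= powR_inv1 ?ltW// muleCA -EFinM mulfV ?gt_eqF//.
by rewrite mule1.
Qed.

(** * The reversible probability *)

Let Z_fine : exists2 z : R, (0 < z)%R & Z = z%:E.
Proof.
have := Zlambda_lty; have := Zlambda_neq0.
have := Zlambda_ge0.
case: (Zlambda pi gamma g t) => [z||]//; rewrite eqe lee_fin => z0 zn0 _.
by exists z => //; rewrite lt_neqAle eq_sym zn0.
Qed.

Let tilt x := Z^-1 * lambda x.

Let measurable_tilt : measurable_fun setT tilt.
Proof. by apply: measurable_funeM; exact: measurable_jump_rate. Qed.

Let tilt_ge0 x : 0 <= tilt x.
Proof. by rewrite mule_ge0 ?jump_rate_ge0// inve_ge0 Zlambda_ge0. Qed.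

Definition tilted : set E -> \bar R := with_density pi measurable_tilt tilt_ge0.

HB.instance Definition _ := Measure.on tilted.

Lemma tiltedE A : measurable A -> tilted A = pi_tilde pi gamma g t A.
Proof.
move=> mA; rewrite /tilted /with_density /pi_tilde ge0_integralZl//.
- by apply: measurable_funTS; exact: measurable_jump_rate.
- by move=> x _; exact: jump_rate_ge0.
- by rewrite inve_ge0 Zlambda_ge0.
Qed.

Let tilted_setT : tilted setT = 1.
Proof.
rewrite tiltedE// /pi_tilde -/(Zlambda pi gamma g t).
by have [z z0 ->] := Z_fine; rewrite inver gt_eqF// -EFinM mulVf// gt_eqF.
Qed.

HB.instance Definition _ := Measure_isProbability.Build _ _ _
  tilted tilted_setT.

(** Monotonicity of [g] is used to show that [tilted] has mass 1 but cannot be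
    recovered from its value by unification, so the probability is named with
    that hypothesis as an argument. *)
Definition tilted_probability : probability E R := tilted.

(** The normalization by [lambda x] in the kernel cancels against the density of
    pi_tilde wherever [lambda] is finite, hence almost everywhere. *)
Lemma tilted_flow A B : measurable A -> measurable B ->
  \int[tilted]_(x in A) jump_kernel gamma g t x B =
  Z^-1 * \int[pi]_(x in A) \int[gamma x]_(y in B) h (x, y).
Proof.
move=> mA mB; have mK : measurable_fun setT (jump_kernel gamma g t ^~ B).
  have -> : jump_kernel gamma g t ^~ B = jump_measure ^~ B.
    by apply/funext => x; rewrite jump_measureE.
  exact: measurable_jump_measure.
have K0 x : 0 <= jump_kernel gamma g t x B.
  by rewrite -jump_measureE measure_ge0.
have Zinv0 : 0 <= Z^-1 by rewrite inve_ge0 Zlambda_ge0.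
(* The density may be infinite on a null set; replacing it by its finite part
   gives the real-valued density that [ge0_integral_density] requires. *)
have tilt_fin : {ae pi, forall x, tilt x = (fine (tilt x))%:E}.
  apply: filterS jump_rate_ae_lty => x /= loo; rewrite fineK// /tilt.
  have [z z0 ->] := Z_fine; rewrite inver gt_eqF// fin_numM//.
  by rewrite ge0_fin_numE// jump_rate_ge0.
have mfine : measurable_fun setT (fine \o tilt).
  exact: (measurableT_comp (fine_measurable measurableT)).
rewrite integral_mkcond (@ge0_integral_density _ _ _ pi _ (fine \o tilt))//.
- rewrite -ge0_integralZl//; last 2 first.
  + by apply: measurable_funTS; exact: measurable_integral_rate.
  + by move=> x _; exact: integral_rate_ge0.
  rewrite [RHS]integral_mkcond; apply: ge0_ae_eq_integral => //.
  + apply: emeasurable_funM; last exact/measurable_EFinP.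
    by apply/(measurable_restrictT _ mA); exact/measurable_funTS.
  + apply/(measurable_restrictT _ mA)/measurable_funTS/measurable_funeM.
    exact: measurable_integral_rate.
  + move=> x _; rewrite mule_ge0//; first by apply: erestrict_ge0.
    by rewrite lee_fin fine_ge0.
  + move=> x _; apply: erestrict_ge0 => y _.
    by rewrite mule_ge0// integral_rate_ge0.
  apply: filterS2 tilt_fin jump_rate_ae_lty => x /= tx loo _.
  rewrite /patch; case: ifPn => _; last by rewrite mul0e.
  by rewrite -tx /tilt muleCA -jump_rate_kernel// [X in _ * X]muleC.
- by move=> x; rewrite fine_ge0.
- move=> C mC; rewrite /tilted /= /with_density.
  apply: ge0_ae_eq_integral => //.
  + exact: measurable_funTS.
  + by apply: measurable_funTS; exact/measurable_EFinP.
  + by move=> x _; rewrite lee_fin fine_ge0.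
  by apply: filterS tilt_fin => x /= tx _.
- by apply/(measurable_restrictT _ mA); exact/measurable_funTS.
- by apply: erestrict_ge0.
Qed.

Lemma jump_kernel_reversible :
  reversible tilted_probability (jump_kernel gamma g t).
Proof.
by move=> A B mA mB; rewrite !tilted_flow// flow_symmetric.
Qed.

End jump_process.

Theorem proposition2p2 (R : realType) (E : ptopologicalType)
    (polE : polish R E)
    (pi : probability (borel E) R) (gamma : R.-pker (borel E) ~> (borel E))
    (t : borel E * borel E -> R) (tP : is_ratio pi gamma t)
    (g : R -> R) (gP : balancing g)
    (g_ndecr : forall r s : R, (0 <= r)%R -> (r <= s)%R -> (g r <= g s)%R)
    (g_cont : {within `[0%R, +oo[%classic, continuous g}) :
  {ae pi, forall x, jump_rate gamma g t x < +oo} /\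
  Zlambda pi gamma g t < +oo /\
  exists tpi : probability (borel E) R,
    (forall A : set (borel E), measurable A ->
       tpi A = pi_tilde pi gamma g t A) /\
    is_markov_kernel (jump_kernel gamma g t) /\
    reversible tpi (jump_kernel gamma g t).
Proof.
split; first exact: (jump_rate_ae_lty tP gP g_ndecr).
split; first exact: (Zlambda_lty tP gP g_ndecr).
exists (tilted_probability tP gP g_ndecr); split.
  exact: tiltedE.
split; first exact: (jump_kernel_markov tP gP).
exact: jump_kernel_reversible.
Qed.
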